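(* Let $G$ be a ($T_1$) sequential topological group with countable $\mathrm{cs}^*$-character. Then $G$ is an $\mathcal{M}_\omega$-group. More precisely, either $G$ is metrizable, or else $G$ contains an open subgroup $H$ which is an $\mathcal{MK}_\omega$-group and $G$ is homeomorphic to the product $H\times D$ for some discrete space $D$.
   Context: All topological spaces (and groups) are assumed to be $T_1$. A space $X$ is sequential if a subset $A\subset X$ is closed whenever it contains the limits of all sequences of points of $A$ that converge in $X$. A family $\mathcal N$ of subsets of $X$ is a $\mathrm{cs}^*$-network at a point $x\in X$ if for every neighborhood $U$ of $x$ and every sequence $(x_n)\subset X$ convergent to $x$ there is $N\in\mathcal N$ with $N\subset U$ such that $x_n\in N$ for infinitely many $n$. Let $\mathrm{cs}^*_\chi(X,x)$ be the smallest size of a $\mathrm{cs}^*$-network at $x$ and $\mathrm{cs}^*_\chi(X)=\sup_{x\in X}\mathrm{cs}^*_\chi(X,x)$. $X$ has countable $\mathrm{cs}^*$-character if $\mathrm{cs}^*_\chi(X)\le\aleph_0$. A space $X$ carries the inductive topology with respect to a cover $\mathcal C$ of $X$ if a set $F\subset X$ is closed in $X$ if and only if $F\cap C$ is closed in $C$ for each $C\in\mathcal C$. An $\mathcal M_\omega$-space (resp. $\mathcal{MK}_\omega$-space) is a space carrying the inductive topology with respect to a countable cover by closed metrizable (resp. compact metrizable) subspaces. An $\mathcal M_\omega$-group (resp. $\mathcal{MK}_\omega$-group) is a topological group whose underlying space is an $\mathcal M_\omega$-space (resp. $\mathcal{MK}_\omega$-space). *)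

(* Defs.v *)
From HB Require Import structures.
From mathcomp Require Import all_boot all_order all_algebra.
From mathcomp Require Import all_classical all_reals topology.

Set Implicit Arguments.
Unset Strict Implicit.
Unset Printing Implicit Defensive.

Local Open Scope classical_set_scope.

HB.mixin Record isTopologicalGroup G of Topological G & Group G := {
  mulg_continuous : continuous (fun x : G * G => (x.1 * x.2)%g) ;
  invg_continuous : continuous (fun x : G => (x^-1)%g)
}.

#[short(type="topologicalGroupType")]
HB.structure Definition TopologicalGroup :=
  {G of Topological G & Group G & isTopologicalGroup G}.

Record subgroup (G : groupType) := Subgroup {
  subgroup_set :> set G ;
  subgroup_closed : group_closed (mem subgroup_set)
}.

(* [subgroup_type H] is [set_type H], with its subspace topology (initial for
   the inclusion in G), equipped in addition with the induced group law. *)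
Definition subgroup_type (G : groupType) (H : subgroup G) : Type :=
  set_type (subgroup_set H).

HB.instance Definition _ (G : groupType) (H : subgroup G) :=
  SubChoice.copy (subgroup_type H) (set_type (subgroup_set H)).

HB.instance Definition _ (G : groupType) (H : subgroup G) :=
  SubChoice_isSubGroup.Build G _ (subgroup_type H) (subgroup_closed H).

HB.instance Definition _ (G : topologicalGroupType) (H : subgroup G) :=
  Topological.copy (subgroup_type H) (set_type (subgroup_set H)).

Section SubgroupTopologicalGroup.
Variables (G : topologicalGroupType) (H : subgroup G).
Let K : topologicalType := subgroup_type H.
Let valH : K -> G := \val.

Let valH_continuous : continuous valH.
Proof. exact: (@initial_continuous (set_type H) G set_val). Qed.

Let continuous_to_subgroup (X : topologicalType) (f : X -> K) :
  continuous (valH \o f) -> continuous f.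
Proof. exact: (@continuous_comp_initial (set_type H) X G set_val f). Qed.

Let subgroup_mulg_continuous :
  continuous (fun x : subgroup_type H * subgroup_type H => (x.1 * x.2)%g).
Proof.
apply: (@continuous_to_subgroup (K * K)%type) => x.
rewrite /continuous_at -(@eq_cvg _ _ _
  (fun x : K * K => (valH x.1 * valH x.2)%g)); last first.
  by move=> y /=; rewrite /valH valM.
rewrite /= /valH valM -/valH.
apply: (@continuous_comp _ _ _ (fun x : K * K => (valH x.1, valH x.2))
  (fun x : G * G => (x.1 * x.2)%g)); last exact: mulg_continuous.
apply: cvg_pair.
- by apply: continuous_comp; [exact: cvg_fst|exact: valH_continuous].
- by apply: continuous_comp; [exact: cvg_snd|exact: valH_continuous].
Qed.

Let subgroup_invg_continuous :
  continuous (fun x : subgroup_type H => (x^-1)%g).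
Proof.
apply: (@continuous_to_subgroup K) => x.
apply: (@continuous_comp K G G valH (fun x : G => (x^-1)%g)).
  exact: valH_continuous.
exact: invg_continuous.
Qed.

HB.instance Definition _ := isTopologicalGroup.Build (subgroup_type H)
  subgroup_mulg_continuous subgroup_invg_continuous.

End SubgroupTopologicalGroup.

Definition homeomorphic (X Y : topologicalType) :=
  exists (f : X -> Y) (g : Y -> X),
    [/\ cancel f g, cancel g f, continuous f & continuous g].

Definition metrizable (R : realType) (X : topologicalType) :=
  exists M : metricType R, homeomorphic X M.

Definition sequential_space (X : topologicalType) :=
  forall A : set X,
    (forall (u : nat -> X) (x : X),
      (forall n, A (u n)) -> u @ \oo --> x -> A x) ->
    closed A.

Definition cs_star_network (X : topologicalType) (x : X) (N : set (set X)) :=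
  forall (U : set X) (u : nat -> X), nbhs x U -> u @ \oo --> x ->
    exists A : set X, [/\ N A, A `<=` U & infinite_set [set n | A (u n)]].

(* The supremum over x of the least cardinality of a cs*-network at x is at
   most aleph_0 iff there is a countable cs*-network at every point. *)
Definition countable_cs_star_character (X : topologicalType) :=
  forall x : X, exists2 N : set (set X), countable N & cs_star_network x N.

(* Here [set_type C] carries the subspace topology, in which the trace of F on
   C is the preimage of F under the inclusion [set_val]. *)
Definition inductive_topology (X : topologicalType) (CC : set (set X)) :=
  \bigcup_(C in CC) C = [set: X] /\
  forall F : set X, closed F <->
    forall C, CC C -> closed ((@set_val X C) @^-1` F : set (set_type C)).

Definition M_omega_space (R : realType) (X : topologicalType) :=
  exists CC : set (set X),
    [/\ countable CC,
        forall C, CC C -> closed C /\ metrizable R (set_type C) &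
        inductive_topology CC].

Definition MK_omega_space (R : realType) (X : topologicalType) :=
  exists CC : set (set X),
    [/\ countable CC,
        forall C, CC C ->
          [/\ closed C, compact C & metrizable R (set_type C)] &
        inductive_topology CC].

Definition M_omega_group (R : realType) (G : topologicalGroupType) :=
  M_omega_space R G.

Definition MK_omega_group (R : realType) (G : topologicalGroupType) :=
  MK_omega_space R G.

(* Main.v *)
Require Import Defs.
From HB Require Import structures.
From mathcomp Require Import all_boot all_order all_algebra.
From mathcomp Require Import all_classical all_reals topology.

(* Let N_0, N_1, ... be a countable cs*-network at 1 made of closed sets.

   If every family of sequences t_n --> 1 has a transversal t_{n_i, k_i} --> 1
   with n_i increasing, then G is Frechet-Urysohn and the finite unions of the
   N_i contain a countable base at 1, so G is metrizable. Otherwise G contains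
   a "fan": sequences t_n --> 1 without such a transversal.

   For a countable set M, the sets x N_{i_1}^-1 ... N_{i_k}^-1 with x in M
   form a countable network at the points of the closure of M; hence 1 is a
   G_delta point of every separable set, and, by a closing-off argument, of
   every sequentially compact set. In particular the fan can be shrunk so that
   its transversals have no limits at all. Such a fan cannot coexist with a
   metric fan, that is, with closed discrete sequences d_n converging uniformly
   to 1. Therefore any sequence converging to 1 meets infinitely often a finite
   intersection of the N_i which is sequentially compact: otherwise these
   intersections would contain a metric fan.

   The subgroup H generated by the countably many sequentially compact finite
   intersections is then open, and it carries the inductive topology with
   respect to the products of these sets. As 1 is a G_delta point of each
   sequentially compact set, the products are compact and metrizable. *)

Set Implicit Arguments.
Unset Strict Implicit.
Unset Printing Implicit Defensive.

Local Open Scope classical_set_scope.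

(** * Properties holding infinitely often, and subsequences of indices *)

Definition io (P : nat -> Prop) := forall N, exists2 n, N <= n & P n.

Definition incr (g : nat -> nat) := forall n, g n < g n.+1.

Definition conv (X : topologicalType) (u : nat -> X) (x : X) :=
  forall U, nbhs x U -> exists N, forall n, N <= n -> U (u n).

Lemma incr_ge g : incr g -> forall n, n <= g n.
Proof. by move=> gi; elim=> // n IH; exact: leq_ltn_trans (gi n). Qed.

Lemma incr_lt g : incr g -> {homo g : m n / m < n}.
Proof. by move=> gi; apply: homo_ltn => //; exact: ltn_trans. Qed.

Lemma incr_comp g h : incr g -> incr h -> incr (g \o h).
Proof. by move=> gi hi n; apply: (incr_lt gi). Qed.

Lemma io_subseq (P : nat -> nat -> Prop) :
  (forall k, io (P k)) -> exists2 g, incr g & forall k, P k (g k).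
Proof.
move=> Pio.
have /choice [f fP] : forall kN : nat * nat, exists n, kN.2 <= n /\ P kN.1 n.
  by move=> [k N]; have [n Nn Pn] := Pio k N; exists n.
pose g := fix g k := if k is k'.+1 then f (k, (g k').+1) else f (0, 0).
exists g; first by move=> n; have [] := fP (n.+1, (g n).+1).
by case=> [|k]; [have [] := fP (0, 0) | have [] := fP (k.+1, (g k).+1)].
Qed.

Lemma io1_subseq (P : nat -> Prop) : io P -> exists2 g, incr g & forall k, P (g k).
Proof. by move=> Pio; apply: (@io_subseq (fun=> P)). Qed.

Lemma not_io P : ~ io P -> exists N, forall n, N <= n -> ~ P n.
Proof.
move=> /existsNP [N nP]; exists N => n Nn Pn; apply: nP; by exists n.
Qed.

Lemma infinite_io (P : nat -> Prop) : infinite_set [set n | P n] <-> io P.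
Proof.
split=> [Pinf N|Pio /finite_seqP [s Ps]].
  apply: contrapT => nP; apply: Pinf.
  apply: (sub_finite_set _ (finite_II N)) => n /= Pn.
  by rewrite ltnNge; apply/negP => Nn; apply: nP; exists n.
have [m sm Pm] := Pio (\max_(i <- s) i).+1.
have ms : m \in s by have : [set` s] m by rewrite -Ps.
by have := @leq_bigmax_seq _ s xpredT id m ms isT; rewrite leqNgt sm.
Qed.

(** If no value recurs infinitely often, [f] tends to infinity, so indices can be chosen along which
    its values increase. *)
Lemma nat_subseq (f : nat -> nat) :
  (exists m, io (fun i => f i = m)) \/ (exists2 g, incr g & incr (f \o g)).
Proof.
have [?|nc] := pselect (exists m, io (fun i => f i = m)); first by left.
right.
have ev m : exists N, forall n, N <= n -> m < f n.
  elim: m => [|m [N NP]].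
    have [N NP] := not_io (fun h => nc (ex_intro _ 0 h)).
    by exists N => n /NP; case: (f n).
  have [M MP] := not_io (fun h => nc (ex_intro _ m.+1 h)).
  exists (maxn N M) => n; rewrite geq_max => /andP [/NP mf /MP fm].
  by rewrite ltn_neqAle mf andbT; apply/eqP => /esym.
have /choice [h hP] := ev.
pose g := fix g k := if k is k'.+1 then maxn (g k').+1 (h (f (g k'))) else 0.
exists g => n /=; first by rewrite leq_maxl.
by apply: hP; rewrite leq_maxr.
Qed.

(** * Convergent sequences *)

Section Conv.
Variable X : topologicalType.
Implicit Types (u : nat -> X) (x : X).

Lemma convP u x : u @ \oo --> x <-> conv u x.
Proof.
split=> [ux U /ux [N _ NP]|ux U /ux [N NP]]; first by exists N.
by exists N.
Qed.

Lemma conv_subseq u x g : incr g -> conv u x -> conv (u \o g) x.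
Proof.
move=> gi ux U /ux [N NP]; exists N => n Nn; apply: NP.
exact: leq_trans (incr_ge gi n).
Qed.

Lemma conv_cst x : conv (fun=> x) x.
Proof. by move=> U /nbhs_singleton Ux; exists 0. Qed.

Lemma conv_near u v x : (exists N, forall n, N <= n -> u n = v n) ->
  conv u x -> conv v x.
Proof.
move=> [N uv] ux U /ux [M MP]; exists (maxn N M) => n.
by rewrite geq_max => /andP [/uv <- /MP].
Qed.

Lemma conv_closed (A : set X) u x : closed A -> conv u x -> io (A \o u) -> A x.
Proof.
move=> cA ux Aio; apply: cA => U /ux [N NP].
by have [n Nn Aun] := Aio N; exists (u n); split=> //; exact: NP.
Qed.

End Conv.

Lemma conv_continuous (X Y : topologicalType) (f : X -> Y) u x :
  continuous f -> conv u x -> conv (f \o u) (f x).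
Proof. by move=> fc ux U /fc /ux. Qed.

Lemma sequential_closed (X : topologicalType) : sequential_space X ->
  forall A : set X, (forall u x, (forall n, A (u n)) -> conv u x -> A x) -> closed A.
Proof. by move=> sX A AP; apply: sX => u x Au /convP ux; exact: AP ux. Qed.

(** * Neighborhoods of 1 and convergence in topological groups *)

Section TopGroup.
Variable G : topologicalGroupType.
Local Open Scope group_scope.
Implicit Types (x y a b : G) (U V : set G) (u v : nat -> G).

Lemma lmulg_continuous a : continuous (fun y : G => a * y).
Proof.
move=> y; apply: (@continuous_comp _ _ _ (fun y : G => (a, y))
  (fun p : G * G => p.1 * p.2)); last exact: mulg_continuous.
by apply: cvg_pair; [exact: cvg_cst|exact: cvg_id].
Qed.

Lemma nbhs_lmul x U : nbhs x U -> nbhs 1 [set v | U (x * v)].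
Proof. by rewrite -{1}[x]mulg1 => /(@lmulg_continuous x 1). Qed.

Lemma nbhs_lmulV x U : nbhs 1 U -> nbhs x [set y | U (x^-1 * y)].
Proof. by rewrite -{1}(mulVg x) => /(@lmulg_continuous x^-1 x). Qed.

Lemma nbhs_mul U : nbhs 1 U ->
  exists2 V, nbhs 1 V & forall a b, V a -> V b -> U (a * b).
Proof.
rewrite -{1}(mulg1 1) => /(@mulg_continuous G (1, 1)) [[/= A B] [A1 B1] AB].
exists (A `&` B); first exact: filterI.
by move=> a b [Aa _] [_ Bb]; exact: (AB (a, b)).
Qed.

Lemma nbhs_inv U : nbhs 1 U -> nbhs 1 [set x | U x^-1].
Proof. by rewrite -{1}invg1 => /(@invg_continuous G 1). Qed.

Lemma nbhs_sym U : nbhs 1 U ->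
  exists V, [/\ nbhs 1 V, forall a, V a -> V a^-1 & forall a b, V a -> V b -> U (a * b)].
Proof.
move=> /nbhs_mul [V V1 VU]; exists (V `&` [set x | V x^-1]); split.
- by apply: filterI => //; exact: nbhs_inv.
- by move=> a [Va Va']; split => //=; rewrite invgK.
- by move=> a b [Va _] [Vb _]; exact: VU.
Qed.

Lemma nbhs_half U : nbhs 1 U ->
  exists V, [/\ nbhs 1 V, closed V, forall a, V a -> V a^-1 &
    forall a b, V a -> V b -> U (a * b)].
Proof.
move=> /nbhs_sym [V [V1 Vs VU]].
have [W [W1 Ws WV]] := nbhs_sym V1.
have clWV : closure W `<=` V.
  move=> x /(_ _ (nbhs_lmulV x W1)) [y [Wy /= Wxy]].
  by rewrite -[x](mulgK (x^-1 * y)) mulVKg; apply: WV => //; exact: Ws.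
exists (closure W); split.
- exact: filterS (@subset_closure _ W) W1.
- exact: closed_closure.
- move=> a aW B /(@invg_continuous G a) Ba.
  have [y [Wy /= By]] := aW _ Ba.
  by exists y^-1; split => //; exact: Ws.
- by move=> a b /clWV Va /clWV Vb; exact: VU.
Qed.

Lemma nbhs_closed U : nbhs 1 U -> exists V, [/\ nbhs 1 V, closed V & V `<=` U].
Proof.
move=> /nbhs_half [V [V1 cV Vs VU]]; exists V; split=> // x Vx.
by rewrite -[x]mulg1; apply: VU => //; exact: nbhs_singleton.
Qed.

Lemma convM u v x y : conv u x -> conv v y -> conv (fun n => u n * v n) (x * y).
Proof.
move=> ux vy U /(@mulg_continuous G (x, y)) [[/= A B] [/ux [N NP] /vy [M MP]] AB].
exists (maxn N M) => n; rewrite geq_max => /andP [Nn Mn].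
by apply: (AB (u n, v n)); split=> /=; [exact: NP|exact: MP].
Qed.

Lemma convV u x : conv u x -> conv (fun n => (u n)^-1) x^-1.
Proof. exact: (conv_continuous (@invg_continuous G)). Qed.

Lemma conv_lmul a u x : conv u x -> conv (fun n => a * u n) (a * x).
Proof. exact: (conv_continuous (@lmulg_continuous a)). Qed.

Lemma conv_lmulV u x : conv u x -> conv (fun n => x^-1 * u n) 1.
Proof. by rewrite -(mulVg x); exact: conv_lmul. Qed.

Hypothesis T1 : accessible_space G.

Lemma t1_nbhs x : x <> 1 -> exists U, nbhs 1 U /\ ~ U x.
Proof.
move=> /eqP; rewrite eq_sym => /T1 [A [oA A1 Ax]].
exists A; split; first by apply: open_nbhs_nbhs; split=> //; exact/set_mem.
by move=> /mem_set h; move: Ax; rewrite inE => /(_ (set_mem h)).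
Qed.

Lemma conv_unique u x y : conv u x -> conv u y -> x = y.
Proof.
move=> ux uy; apply: contrapT => xy.
have /t1_nbhs [U [/nbhs_half [V [V1 _ Vs VU]] nU]] : x^-1 * y <> 1.
  by move=> h; apply: xy; rewrite -[y](mulKg x^-1) h invgK mulg1.
apply: nU.
have [N NP] := conv_lmulV ux V1; have [M MP] := conv_lmulV uy V1.
have -> : x^-1 * y = (x^-1 * u (maxn N M)) * (y^-1 * u (maxn N M))^-1.
  by rewrite invgM invgK mulgA mulgK.
by apply: VU; [apply: NP|apply/Vs/MP]; rewrite ?leq_maxl ?leq_maxr.
Qed.

End TopGroup.

(** * Separable and sequentially compact sets *)

Definition seq_compact (X : topologicalType) (C : set X) :=
  forall u, (forall n, C (u n)) ->
  exists x g, [/\ incr g, C x & conv (u \o g) x].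

Section Network.
Variable G : topologicalGroupType.
Local Open Scope group_scope.
Implicit Types (x y a b p q : G) (U V C M : set G) (u v : nat -> G).

Definition closed_cs_network (N : nat -> set G) :=
  (forall i, closed (N i)) /\
  forall U u, nbhs 1 U -> conv u 1 -> exists2 i, N i `<=` U & io (N i \o u).

(** Closures can replace the given sets because closed neighborhoods form a base at 1. *)
Lemma closed_cs_network_ex : countable_cs_star_character G ->
  exists N, closed_cs_network N.
Proof.
move=> /(_ 1) [NN cN csN].
move/pfcard_geP: cN => [N0|/unsquash f].
  have [A []] := csN setT (fun=> 1) filterT (cvg_cst _).
  by rewrite N0.
exists (fun i => closure (f i)); split=> [i|U u U1 /convP u1].
  exact: closed_closure.
have [V [V1 cV VU]] := nbhs_closed U1.
have [A [NA AV /infinite_io Au]] := csN V u V1 u1.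
have [i _ fi] := @surj _ _ _ _ f A NA.
exists i; rewrite ?fi.
  by apply: subset_trans VU; rewrite (closure_id V).1 //; exact: closureS.
by move=> n; have [m nm Am] := Au n; exists m => //; exact: subset_closure.
Qed.

Hypothesis T1 : accessible_space G.
Hypothesis seqG : sequential_space G.
Variable N : nat -> set G.
Hypothesis csN : closed_cs_network N.

Fixpoint word_set x (w : seq nat) : set G :=
  if w is i :: w' then [set a * b^-1 | a in word_set x w' & b in N i]
  else [set x].

Lemma closed_lmul a V : closed V -> closed [set y | V (a * y)].
Proof.
move=> cV; apply: (closed_comp _ cV) => y _; exact: lmulg_continuous.
Qed.

(** The points [q] with this property include [M], by empty words, and form a sequentially closed
    set: a limit q of points u_j equals u_j (q^-1 u_j)^-1, where q^-1 u_j can be taken in a small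
    [N i]. *)
Lemma word_set_network M q W : closure M q -> nbhs q W ->
  exists x w, [/\ M x, word_set x w q & word_set x w `<=` W].
Proof.
pose Y := [set q | forall W, nbhs q W ->
  exists x w, [/\ M x, word_set x w q & word_set x w `<=` W]].
suff cY : closed Y.
  suff MY : M `<=` Y.
    move=> Mq; have : Y q by rewrite (closure_id Y).1 //; exact: closureS Mq.
    exact.
  move=> x Mx V Vx; exists x, [::]; split => //= _ ->.
  exact: nbhs_singleton.
apply: sequential_closed => // u {}q uY uq {}W Wq.
have [A A1 AW] := nbhs_mul (nbhs_lmul Wq).
have [V [V1 Vs VA]] := nbhs_sym A1.
have [i NiV Niu] := csN.2 V _ V1 (conv_lmulV uq).
have [j _ /= Nij] := Niu 0.
have Vj := NiV _ Nij.
have A1' a : V a -> A a by move=> Va; rewrite -[a]mulg1; apply: VA => //; exact: nbhs_singleton.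
have [x [w [Mx xj xV]]] := uY j _ (nbhs_lmulV (u j) V1).
exists x, (i :: w); split => //=.
  by exists (u j) => //; exists (q^-1 * u j) => //; rewrite invgM invgK mulVKg.
move=> _ [a /xV /= Va] [b /NiV Vb <-].
have -> : a * b^-1 = q * ((q^-1 * u j) * (((u j)^-1 * a) * b^-1)).
  by rewrite !mulgA mulgV mul1g mulgV mul1g.
by apply: AW; [exact: A1'|apply: VA => //; exact: Vs].
Qed.

(** The neighborhoods are chosen once for all sets [T], with default [setT] when 1 is in the closure
    of [T]; later only countably many word sets are used. *)
Lemma separating_nbhs : exists S : set G -> set G, forall T,
  [/\ nbhs 1 (S T), closed (S T) & ~ closure T 1 -> S T `&` T = set0].
Proof.
suff /choice [S SP] : forall T : set G, exists V, [/\ nbhs 1 V, closed V &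
  ~ closure T 1 -> V `&` T = set0] by exists S.
move=> T; have [T1'|nT] := pselect (closure T 1).
  by by exists setT; split => //; exact: filterT.
have : nbhs 1 (~` closure T).
  by apply: open_nbhs_nbhs; split => //; exact/closed_openC/closed_closure.
move=> /nbhs_closed [V [V1 cV VT]]; exists V; split => // _.
by apply/seteqP; split=> // x [/VT xT /subset_closure].
Qed.

(** If q <> 1, some word set contains [q] and lies in a closed neighborhood of [q] that misses 1;
    then [S] separates this word set from 1 and excludes [q]. *)
Lemma separating_closure (S : set G -> set G) M q :
  (forall T, [/\ nbhs 1 (S T), closed (S T) & ~ closure T 1 -> S T `&` T = set0]) ->
  closure M q -> (forall x w, M x -> S (word_set x w) q) -> q = 1.
Proof.
move=> SP Mq Sq; apply: contrapT => q1.
have [U [U1 nU]] : exists U, nbhs 1 U /\ ~ U q^-1.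
  by apply: t1_nbhs => // h; apply: q1; rewrite -[q]invgK h invg1.
have [V [V1 cV VU]] := nbhs_closed U1.
have [x [w [Mx xq xV]]] := word_set_network Mq (nbhs_lmulV q V1).
have [_ _ ST] := SP (word_set x w).
suff /ST ST0 : ~ closure (word_set x w) 1.
  by have : set0 q by rewrite -ST0; split=> //; exact: Sq.
move=> /(closureS xV); rewrite -(closure_id _).1; last exact: closed_lmul.
by rewrite /= mulg1 => /VU.
Qed.

(** This makes 1 a G_delta point relative to [C], whether or not 1 is in [C]. *)
Definition point_sequence C (V : nat -> set G) :=
  [/\ forall n, nbhs 1 (V n), forall n, closed (V n) &
      forall p, C p -> (forall n, V n p) -> p = 1].

Lemma point_sequence_countType (I : countType) C (F : I -> set G) :
  (forall i, nbhs 1 (F i)) -> (forall i, closed (F i)) ->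
  (forall p, C p -> (forall i, F i p) -> p = 1) ->
  exists S, point_sequence C S.
Proof.
move=> F1 cF FC; exists (fun n => if unpickle n is Some i then F i else setT).
split=> [n|n|p Cp Fp].
- by case: unpickle => // *; exact: filterT.
- by case: unpickle => // *; exact: closedT.
- by apply: FC => // i; have := Fp (pickle i); rewrite pickleK.
Qed.

Lemma point_sequence_closure (I : countType) (t : I -> G) :
  exists S, point_sequence (closure (range t)) S.
Proof.
have [S SP] := separating_nbhs.
apply: (@point_sequence_countType (I * seq nat)%type _
  (fun r => S (word_set (t r.1) r.2))).
- by move=> i; have [] := SP (word_set (t i.1) i.2).
- by move=> i; have [] := SP (word_set (t i.1) i.2).
- move=> p tp Sp; apply: (separating_closure SP tp) => _ w [i _ <-].
  exact: (Sp (i, w)).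
Qed.

(* The points [pt t] form a countable subset of [C] such that any point [p] of
   [C] lying in all the separating neighborhoods attached to it can be
   approximated, within these neighborhoods, by points [pt t] agreeing with [p]
   on more and more members of the network; such approximations converge to 1. *)
Lemma point_sequence_seq_compact C : seq_compact C ->
  exists S, point_sequence C S.
Proof.
move=> scC; have [S SP] := separating_nbhs.
pose O (L : seq (G * seq nat)) (s : seq bool) := [set z | [/\ C z,
  forall r, r \in L -> S (word_set r.1 r.2) z &
  forall i, i < size s -> nth false s i = `[< N i z >]]].
pose pick (n : nat) (xs : seq G) :=
  if unpickle n is Some (ws, s) then xget 1 (O (zip xs ws) s) else 1.
(* A tree codes a point: its children code earlier points, its label the words attached to them and
   a membership pattern. Trees form a countable type. *)
pose pt := fix pt (t : GenTree.tree nat) : G :=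
  if t is GenTree.Node n ts then pick n (map pt ts) else 1.
apply: (@point_sequence_countType (GenTree.tree nat * seq nat)%type _
  (fun r => S (word_set (pt r.1) r.2))).
- by move=> i; have [] := SP (word_set (pt i.1) i.2).
- by move=> i; have [] := SP (word_set (pt i.1) i.2).
move=> p Cp Sp; apply: contrapT => p1.
(* Stage [j] takes the constraints from all pairs with code below [j] and the memberships of [p] in
   the first [j] sets of the network. *)
pose rs j : seq (GenTree.tree nat * seq nat) := pmap unpickle (iota 0 j).
pose pat j := [seq `[< N i p >] | i <- iota 0 j].
pose tr j := GenTree.Node (pickle (map snd (rs j), pat j)) (map fst (rs j)).
have ptO j : O [seq (pt r.1, r.2) | r <- rs j] (pat j) (pt (tr j)).
  rewrite /= /pick pickleK -map_comp.
  set L := zip _ _.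
  have -> : L = [seq (pt r.1, r.2) | r <- rs j] by rewrite /L zip_map.
  apply: (@xgetI _ _ _ p); split=> //.
    by move=> _ /mapP [r _ ->] /=; exact: Sp.
  move=> i; rewrite size_map size_iota => ij.
  by rewrite (nth_map 0) ?size_iota // nth_iota.
have [q [g [gi Cq gq]]] := scC (pt \o tr) (fun j => let: And3 a _ _ := ptO j in a).
(* The constraint given by a pair (t, w) holds at all stages beyond its code, hence for the limit
   [q]. *)
have q1 : q = 1.
  apply: (@separating_closure S (range pt)) => //.
    move=> U /gq [n nP]; exists (pt (tr (g n))); split; first by exists (tr (g n)).
    exact: (nP n).
  move=> _ w [t _ <-]; have [_ cS _] := SP (word_set (pt t) w).
  apply: (conv_closed cS gq) => n.
  exists (maxn n (pickle (t, w)).+1); first exact: leq_maxl.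
  set m := maxn _ _; have [_ /(_ (pt t, w)) h _] := ptO (g m); apply: h.
  apply/mapP; exists (t, w) => //; rewrite mem_pmap; apply/mapP.
  exists (pickle (t, w)); last by rewrite pickleK.
  by rewrite mem_iota /= (leq_trans _ (incr_ge gi _)) // leq_maxr.
rewrite {}q1 in gq.
(* A member of the network inside [U] catches a late approximation, hence by the pattern also
   [p]. *)
have [U [U1 nU]] := t1_nbhs T1 p1.
have [i NiU Nig] := csN.2 U _ U1 gq.
have [m im /= Nim] := Nig i.+1.
have [_ _ /(_ i)] := ptO (g m).
rewrite size_map size_iota (leq_trans im) ?incr_ge // => /(_ isT).
rewrite (nth_map 0) ?size_iota ?(leq_trans im) ?incr_ge // nth_iota ?(leq_trans im) ?incr_ge //.
by rewrite add0n (asboolT Nim) => /asboolP /NiU.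
Qed.

End Network.

(** * Fans *)

Section Fans.
Variable G : topologicalGroupType.
Local Open Scope group_scope.
Implicit Types (x y a b : G) (U V C : set G) (u v : nat -> G).

Definition fan (t : nat -> nat -> G) :=
  (forall n, conv (t n) 1) /\
  forall g k, incr g -> ~ conv (fun i => t (g i) (k i)) 1.

Definition metric_fan (d : nat -> nat -> G) :=
  (forall n g x, incr g -> ~ conv (d n \o g) x) /\
  forall U, nbhs 1 U -> exists m, forall n, m <= n -> forall k, U (d n k).

Definition base_at_1 (B : nat -> set G) :=
  (forall n, nbhs 1 (B n)) /\ forall U, nbhs 1 U -> exists n, B n `<=` U.

Hypothesis T1 : accessible_space G.
Hypothesis seqG : sequential_space G.
Variable N : nat -> set G.
Hypothesis csN : closed_cs_network N.

(** The limits of sequences from [A] form a sequentially closed set: if v_n -> y and w_{n,k} -> v_n,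
    a transversal of the v_n^-1 w_{n,k} converging to 1 yields a transversal of [w] converging to
    y. *)
Lemma no_fan_frechet A x : (forall t, ~ fan t) -> closure A x ->
  exists2 u : nat -> G, (forall n, A (u n)) & conv u x.
Proof.
move=> nofan.
pose A1 := [set y | exists2 u : nat -> G, (forall n, A (u n)) & conv u y].
suff cA1 : closed A1.
  move=> Ax; have : A1 x; last by [].
  rewrite (closure_id A1).1 //; apply: closureS Ax => y Ay.
  by exists (fun=> y) => //; exact: conv_cst.
apply: sequential_closed => // v y vA vy.
have /choice [w wP] : forall n, exists w : nat -> G,
    (forall m, A (w m)) /\ conv w (v n) by move=> n; have [w] := vA n; exists w.
pose t n k := (v n)^-1 * w n k.
have t1 n : conv (t n) 1 by apply: conv_lmulV; have [] := wP n.
have : ~ fan t by [].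
move=> /not_andP [//|/existsNP [g /existsNP [k /not_implyP [gi /contrapT tc]]]].
exists (fun i => w (g i) (k i)); first by move=> i; have [] := wP (g i).
have := convM (conv_subseq gi vy) tc; rewrite mulg1.
by apply: conv_near; exists 0 => i _; rewrite /= /t mulVKg.
Qed.

(** Otherwise there are sequences t_n -> 1 avoiding every [N i] inside [U] with i <= n; a
    transversal converging to 1 would be caught by one of these sets at late indices. *)
Lemma no_fan_network U : (forall t, ~ fan t) -> nbhs 1 U ->
  exists n, forall u, conv u 1 ->
    ~ io (fun m => forall i, i <= n -> N i `<=` U -> ~ N i (u m)).
Proof.
move=> nofan U1; apply: contrapT => /forallNP nU.
have {}nU n : exists u, conv u 1 /\
    forall m i, i <= n -> N i `<=` U -> ~ N i (u m).
  have /existsNP [u /not_implyP [u1 /contrapT /io1_subseq [g gi gP]]] := nU n.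
  by exists (u \o g); split => //; exact: conv_subseq.
have /choice [t tP] := nU.
have : ~ fan t by [].
move=> /not_andP [|/existsNP [g /existsNP [k /not_implyP [gi /contrapT tc]]]].
  by apply=> n; have [] := tP n.
have [i NiU Nit] := csN.2 U _ U1 tc.
have [m im /= Nm] := Nit i.
have [_ /(_ (k m) i)] := tP (g m); apply => //.
by rewrite (leq_trans im) ?incr_ge.
Qed.

(** Without fans, let n be as in [no_fan_network]. The union of the [N i] inside [U] with i <= n is
    a neighborhood of 1, since otherwise a sequence in its complement would converge to 1. *)
Lemma fan_or_base : (exists t, fan t) \/ exists B, base_at_1 B.
Proof.
have [?|/forallNP nofan] := pselect (exists t, fan t); [by left|right].
pose F (s : seq nat) := [set x | exists2 i, i \in s & N i x].
pose B (n : nat) : set G := if unpickle n is Some s then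
  (if pselect (nbhs 1 (F s)) then F s else setT) else setT.
exists B; split=> [n|U U1].
  rewrite /B; case: unpickle => [s|]; last exact: filterT.
  by case: pselect => [h|_] /=; [exact: h|exact: filterT].
have [n nP] := no_fan_network nofan U1.
pose s := [seq i <- iota 0 n.+1 | `[< N i `<=` U >]].
exists (pickle s) => x; rewrite /B pickleK; case: pselect => [h|nF] /=.
  by move=> [i]; rewrite mem_filter => /andP [/asboolP NiU _] /NiU.
exfalso; apply: nF; have [//|nF] := pselect (nbhs 1 (F s)).
have : closure (~` F s) 1.
  move=> V V1; apply: contrapT => FV; apply: nF; apply: filterS V1 => y Vy.
  by apply: contrapT => Fy; apply: FV; exists y.
move=> /(no_fan_frechet nofan) [u uF /nP]; case => m; exists m => // i im NiU Ni.
apply: (uF m); exists i => //; rewrite mem_filter mem_iota /= add0n ltnS im.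
by rewrite andbT; exact/asboolP.
Qed.

(* In the product of a closed metric fan and a closed Frechet-Urysohn fan the
   diagonal set {(d n k, t n k)} is sequentially closed but accumulates at the
   vertex; the same happens to the set of products [d n k * t n k]. *)
Lemma fan_no_metric_fan t d : fan t -> metric_fan d -> False.
Proof.
move=> [t1 tn] [dn d1].
have [S [S1 cS SP]] :=
  point_sequence_closure T1 seqG csN (fun r : nat * nat => t r.1 r.2).
(* From index [K n] on, row n lies in [S 0], ..., [S n]. A limit of a transversal of the shifted
   rows then lies in every [S i], so it is 1, which a fan forbids. *)
have /choice [K KP] : forall n, exists m, forall k, m <= k ->
    forall i, i <= n -> S i (t n k).
  move=> n; elim: {1}n => [|j [m mP]].
    have [m mP] := t1 n _ (S1 0); exists m => k mk [|//] _; exact: mP.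
  have [m' mP'] := t1 n _ (S1 j.+1); exists (maxn m m') => k.
  rewrite geq_max => /andP [mk mk'] i; rewrite leq_eqVlt => /orP [/eqP ->|].
    exact: mP'.
  by rewrite ltnS; exact: mP.
pose s n k := t n (K n + k).
have s1 n : conv (s n) 1.
  apply: (@conv_subseq _ (t n) 1 (fun k => K n + k)) => // k.
  by rewrite addnS.
have sn g k x : incr g -> ~ conv (fun i => s (g i) (k i)) x.
  move=> gi sx; apply: (tn g (fun i => K (g i) + k i) gi).
  suff <- : x = 1 by [].
  apply: SP.
    move=> U /sx [m mP]; exists (s (g m) (k m)); split; last exact: mP.
    by exists (g m, K (g m) + k m).
  move=> i; apply: (conv_closed (cS i) sx) => m.
  exists (maxn i m); first exact: leq_maxr.
  apply: KP; first exact: leq_addr.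
  by apply: leq_trans (incr_ge gi _); exact: leq_maxl.
pose A := [set x | x <> 1 /\ exists n k, x = d n k * s n k].
have cA : closed A.
  apply: sequential_closed => // u x uA ux.
  have /choice [n] : forall i, exists n, exists k, u i = d n k * s n k.
    by move=> i; have [_] := uA i.
  move=> /choice [k uE].
  (* Row indices tending to infinity would make the [d] factors tend to 1, so that a transversal of
     [s] would converge; hence one row m recurs. *)
  have [[m /io1_subseq [g gi gP]]|[g gi ngi]] := nat_subseq n; last first.
    exfalso; apply: (sn (n \o g) (k \o g) x ngi).
    have d1' : conv (fun i => d (n (g i)) (k (g i))) 1.
      move=> U /d1 [m mP]; exists m => i mi; apply: mP.
      exact: leq_trans (incr_ge ngi i).
    have := convM (convV d1') (conv_subseq gi ux).
    rewrite invg1 mul1g; apply: conv_near; exists 0 => i _ /=.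
    by rewrite uE mulKg.
  (* Within row m, column indices tending to infinity would make a subsequence of [d m] converge; so
     a single product recurs. *)
  have [[l /io1_subseq [h hi hP]]|[h hi khi]] := nat_subseq (k \o g); last first.
    exfalso; apply: (dn m (k \o g \o h) x khi).
    have sx : conv (fun i => s m (k (g (h i)))) 1 by exact: conv_subseq khi (s1 m).
    have := convM (conv_subseq (incr_comp gi hi) ux) (convV sx).
    rewrite invg1 mulg1; apply: conv_near; exists 0 => i _ /=.
    by rewrite uE gP mulgK.
  suff <- : u (g (h 0)) = x by exact: uA.
  apply: (conv_unique T1 _ (conv_subseq (incr_comp gi hi) ux)).
  have -> : u \o (g \o h) = fun=> u (g (h 0)).
    apply/funext => i /=; rewrite !uE !gP; have /= := hP i; have /= := hP 0.
    by move=> -> ->.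
  exact: conv_cst.
have : A 1; last by case.
rewrite (closure_id A).1 // => U /nbhs_mul [V V1 VU].
have [n /(_ n (leqnn _)) nV] := d1 _ V1.
have [m mP] := s1 n _ V1.
suff [k mk k1] : exists2 k, m <= k & d n k * s n k <> 1.
  by exists (d n k * s n k); split; [split=> //; exists n, k|apply: VU => //; exact: mP].
(* If all late products were 1, row [d n] would converge to 1. *)
apply: contrapT => h; apply: (dn n id 1) => //.
have := convV (s1 n); rewrite invg1; apply: conv_near; exists m => k mk.
have : d n k * s n k = 1 by apply: contrapT => hk; apply: h; exists k.
by move=> /(canRL (mulgK _)) dE; rewrite /= dE mul1g.
Qed.

(** Some subsequence of [u] is, for each i, eventually inside or eventually outside [N i]. If no
    finite intersection of the members containing it eventually were sequentially compact, sequences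
    in these intersections without convergent subsequences would form a metric fan. *)
Lemma fan_seq_compact_network t u : fan t -> conv u 1 ->
  exists2 s : seq nat, seq_compact [set x | forall i, i \in s -> N i x] &
    io (fun n => forall i, i \in s -> N i (u n)).
Proof.
move=> tfan u1.
(* [B j] is an infinite set of indices; its successor keeps the part where [u] is in [N j] if that
   is infinite, and otherwise the rest. *)
pose B := fix B (i : nat) : set nat := if i is j.+1 then
  (if pselect (io (fun n => B j n /\ N j (u n))) then
    [set n | B j n /\ N j (u n)] else [set n | B j n /\ ~ N j (u n)]) else setT.
have Bio i : io (B i).
  elim: i => [n|j IH /=]; first by exists n.
  case: pselect => [//|h /=]; have [m mP] := not_io h => n.
  have [k] := IH (maxn m n); rewrite geq_max => /andP [mk nk] Bk.
  by exists k => //; split=> // Nk; apply: (mP k mk).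
have Bdec i j : i <= j -> B j `<=` B i.
  move=> /subnKC <-; elim: (j - i) => [|k IH]; first by rewrite addn0.
  by rewrite addnS; apply: subset_trans IH => n /=; case: pselect => h [].
have [g gi gB] := io_subseq Bio.
have ugc := conv_subseq gi u1.
pose good i := B i.+1 `<=` [set n | N i (u n)].
have goodP U : nbhs 1 U -> exists2 i, N i `<=` U & good i.
  move=> U1; have [i NiU Niu] := csN.2 U _ U1 ugc; exists i => //.
  rewrite /good /=; case: pselect => [h|h] /=; first by move=> n []. exfalso; apply: h.
  move=> n; have [m nm Nm] := Niu (maxn n i).
  rewrite geq_max in nm; case/andP: nm => nm im.
  exists (g m); first exact: leq_trans (incr_ge gi m).
  by split => //; exact: (Bdec i m).
pose s n := [seq i <- iota 0 n | `[< good i >]].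
apply: contrapT => h.
suff [d md] : exists d, metric_fan d by exact: fan_no_metric_fan tfan md.
have /choice [d dP] : forall n, exists d : nat -> G,
    (forall k i, i \in s n -> N i (d k)) /\
    forall g x, incr g -> ~ conv (d \o g) x.
  move=> n; apply: contrapT => /forallNP nd; apply: h; exists (s n).
    move=> d dN; have /not_andP [//|] := nd d.
    move=> /existsNP [f /existsNP [x /not_implyP [fi /contrapT dx]]].
    exists x, f; split=> // i si.
    apply: (conv_closed (csN.1 i) dx) => m; exists m => //; exact: dN.
  move=> m; exists (g (maxn m n)).
    by apply: leq_trans (incr_ge gi _); exact: leq_maxl.
  move=> i; rewrite mem_filter mem_iota add0n => /andP [/asboolP gdi /andP [_ ilt]].
  by apply: gdi; apply: Bdec (gB _); rewrite (leq_trans ilt) // leq_maxr.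
exists d; split=> [n|U U1]; first by have [] := dP n.
have [i NiU gdi] := goodP U U1; exists i.+1 => n ni k.
apply: NiU; have [] := dP n; move=> /(_ k i) + _; apply.
by rewrite mem_filter mem_iota add0n ni /= andbT; exact/asboolP.
Qed.

Definition compact_cs_network (K : nat -> set G) :=
  [/\ forall n, seq_compact (K n), forall n x, K n x -> K n x^-1 &
      forall u, conv u 1 -> exists n, io (K n \o u)].

(** [K] lists the sequentially compact finite intersections, each united with its inverse; other
    codes give the empty set. *)
Lemma fan_compact_network t : fan t -> exists K, compact_cs_network K.
Proof.
move=> tfan.
pose C (s : seq nat) := [set x | forall i, i \in s -> N i x].
pose K (n : nat) : set G := if unpickle n is Some s then
  (if pselect (seq_compact (C s)) then C s `|` [set x | C s x^-1] else set0)
  else set0.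
exists K; split=> [n|n x|u u1].
- rewrite /K; case: unpickle => [s|]; last by move=> u /(_ 0).
  case: pselect => [Cs|h] /=; last by move=> u /(_ 0).
  move=> u uC; have [cio|/not_io [m mP]] := pselect (io (C s \o u)).
    have [g gi gC] := io1_subseq cio.
    have [x [h [hi Cx ux]]] := Cs _ gC.
    by exists x, (g \o h); split; [exact: incr_comp|left|].
  have [|x [h [hi Cx ux]]] := Cs (fun n => (u (m + n))^-1).
    by move=> k; have [/(mP _ (leq_addr _ _))|] := uC (m + k).
  exists x^-1, (fun k => m + h k); split.
  - by move=> k; rewrite ltn_add2l.
  - by right; rewrite /= invgK.
  - have := convV ux; apply: conv_near; exists 0 => k _ /=; by rewrite invgK.
- rewrite /K; case: unpickle => // s; case: pselect => //= h [Cx|Cx].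
    by right; rewrite /= invgK.
  by left.
- have [s Cs su] := fan_seq_compact_network tfan u1.
  exists (pickle s); rewrite /K pickleK; case: pselect => //= h n.
  by have [m nm Cm] := su n; exists m => //; left.
Qed.

End Fans.

(** * Metrizability *)

Section MetricOfPseudoMetric.
Import Order.TTheory GRing.Theory Num.Theory.
Local Open Scope ring_scope.
Variables (R : realType) (T : pseudoMetricType R).
Hypothesis sepT : forall x y : T, (forall e : R, 0 < e -> ball x e y) -> x = y.

Let radii (x y : T) : set R := [set e | 0 < e /\ (ball x e y \/ 1 <= e)].
Let dist (x y : T) : R := inf (radii x y).

Let radii_has_inf x y : has_inf (radii x y).
Proof.
split; first by exists 1; split; [exact: ltr01|right].
by exists 0 => e [e0 _]; exact: ltW.
Qed.

Let dist_ge0 x y : 0 <= dist x y.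
Proof.
apply: lb_le_inf; first by have [] := radii_has_inf x y.
by move=> e [e0 _]; exact: ltW.
Qed.

Let dist_le x y e : 0 < e -> ball x e y -> dist x y <= e.
Proof.
move=> e0 xy; apply: ge_inf; first by have [] := radii_has_inf x y.
by split=> //; left.
Qed.

Let dist_lt x y e : dist x y < e -> e <= 1 -> ball x e y.
Proof.
move=> /inf_lt [|r [r0 xr] re e1]; first by have [] := radii_has_inf x y.
case: xr => [|r1]; first by apply: le_ball; exact: ltW.
by have := lt_le_trans re e1; rewrite ltNge r1.
Qed.

Let distxx x : dist x x = 0.
Proof.
apply/eqP; rewrite eq_le dist_ge0 andbT; apply/ler_addgt0Pr => e e0.
by rewrite add0r; apply: dist_le => //; exact: ballxx.
Qed.

Let dist_positivity x y : dist x y = 0 -> x = y.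
Proof.
move=> xy; apply: sepT => e e0.
have : ball x (Num.min e 1) y.
  by apply: dist_lt; rewrite ?ge_min ?lexx ?orbT // xy lt_min e0 ltr01.
by apply: le_ball; rewrite ge_min lexx.
Qed.

Let dist_sym x y : dist x y = dist y x.
Proof.
by congr inf; apply/seteqP; split=> e [e0 []] h; split=> //; (left; exact: ball_sym) || right.
Qed.

Let dist_triangle y x z : dist x z <= dist x y + dist y z.
Proof.
apply/ler_addgt0Pr => e e0.
have e20 : 0 < e / 2 by rewrite divr_gt0.
have [r [r0 xr] rd] := inf_adherent e20 (radii_has_inf x y).
have [s [s0 ys] sd] := inf_adherent e20 (radii_has_inf y z).
have rs0 : 0 < r + s by rewrite addr_gt0.
apply: (@le_trans _ _ (r + s)); last first.
  by rewrite [e]splitr addrACA; apply: lerD; exact: ltW.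
apply: ge_inf; first by have [] := radii_has_inf x z.
split=> //; case: xr => [xr|r1]; last by right; rewrite (le_trans r1) // lerDl ltW.
case: ys => [ys|s1]; last by right; rewrite (le_trans s1) // lerDr ltW.
by left; exact: ball_triangle ys.
Qed.

(** Mentioning [sepT] makes the separation proof a parameter of the type, where the metric instance
    can find it. *)
Definition metric_of : Type := let _ := sepT in T.

HB.instance Definition _ := Choice.on metric_of.
HB.instance Definition _ := @isMetric.Build R metric_of
  dist distxx dist_positivity dist_sym dist_triangle.

Lemma pseudometric_metrizable : metrizable R T.
Proof.
exists metric_of, (fun x => x : metric_of), (fun x => x : T); split => //.
- move=> x A /nbhs_ballP [e /= e0 eA]; apply/nbhs_ballP.
  have m0 : 0 < Num.min e 1 / 2 by rewrite divr_gt0 // lt_min e0 ltr01.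
  exists (Num.min e 1 / 2) => // y /(dist_le m0) xy; apply: eA.
  rewrite ballEmdist /=; apply: le_lt_trans xy _.
  rewrite ltr_pdivrMr // (@le_lt_trans _ _ e) ?ge_min ?lexx //.
  by rewrite ltr_pMr // ltr1n.
- move=> x A /nbhs_ballP [e /= e0 eA]; apply/nbhs_ballP.
  exists (Num.min e 1); first by rewrite /= lt_min e0 ltr01.
  move=> y; rewrite ballEmdist /= => xy; apply: eA.
  apply: (@le_ball _ _ _ (Num.min e 1)); first by rewrite ge_min lexx.
  by apply: dist_lt; rewrite ?ge_min ?lexx ?orbT.
Qed.

End MetricOfPseudoMetric.

Lemma uniform_metrizable (R : realType) (T : uniformType) :
  countable_uniformity T ->
  (forall x y : T, (forall A, entourage A -> A (x, y)) -> x = y) ->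
  metrizable R T.
Proof.
move=> cT sepT.
pose P : pseudoMetricType R := countable_uniform cT.
apply: (@pseudometric_metrizable R P) => x y xy; apply: sepT => A.
rewrite -[entourage A]/(@entourage P A) -entourage_ballE => -[e /= e0].
by apply; exact: xy.
Qed.

Section Embedding.
Variables (G : topologicalGroupType) (X : topologicalType) (j : X -> G).
Local Open Scope group_scope.
Implicit Types (V W : nat -> set G).

Definition embedding := injective j /\
  forall x U, nbhs x U <-> exists2 O, nbhs (j x) O & j @^-1` O `<=` U.

(** The left translates of the [V n] trace neighborhood bases on [Z], so countably many left
    entourages describe its topology. *)
Definition left_uniform_base (Z : set G) V :=
  (forall n, nbhs 1 (V n)) /\
  forall x O, Z x -> nbhs x O ->
    exists n, forall y, Z y -> V n (x^-1 * y) -> O y.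

(** The sequence of the Birkhoff-Kakutani theorem, built by halving the intersection of [W n] and
    [V n.+1]. *)
Lemma nbhs_sequence V : (forall n, nbhs 1 (V n)) -> exists W,
  [/\ forall n, nbhs 1 (W n), forall n, W n `<=` V n,
      forall n a, W n a -> W n a^-1, forall m n, m <= n -> W n `<=` W m &
      forall n a b, W n.+1 a -> W n.+1 b -> W n (a * b)].
Proof.
move=> V1.
have /choice [h hP] : forall U : set G, exists H, nbhs 1 U ->
    [/\ nbhs 1 H, forall a, H a -> H a^-1 & forall a b, H a -> H b -> U (a * b)].
  move=> U; have [/nbhs_sym [H HP]|nU] := pselect (nbhs 1 U); first by exists H.
  by exists set0.
pose W := fix W n := h (if n is m.+1 then W m `&` V n else V 0).
have W1 n : nbhs 1 (W n).
  elim: n => [|n IH]; first by have [] := hP _ (V1 0).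
  by have [] := hP _ (filterI IH (V1 n.+1)).
have WP n : [/\ nbhs 1 (W n.+1), forall a, W n.+1 a -> W n.+1 a^-1 &
    forall a b, W n.+1 a -> W n.+1 b -> (W n `&` V n.+1) (a * b)].
  by apply: hP; exact: filterI.
have W0P := hP _ (V1 0).
have WW n a b : W n.+1 a -> W n.+1 b -> W n (a * b).
  by have [_ _ HW] := WP n => Wa Wb; have [] := HW a b Wa Wb.
exists W; split=> // [n a Wa|n a Wa|m n].
- case: n Wa => [|n] Wa; rewrite -[a]mulg1.
    by have [H1 _] := W0P; apply => //; exact: nbhs_singleton.
  by have [H1 _ /(_ a 1 Wa (nbhs_singleton H1)) []] := WP n.
- by case: n Wa => [|n] Wa; [have [_ H _] := W0P|have [_ H _] := WP n]; exact: H.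
- move=> /subnKC <-; elim: (n - m) => [|k IH]; first by rewrite addn0.
  rewrite addnS => a Wa; apply: IH; rewrite -[a]mulg1; apply: WW => //.
  exact: nbhs_singleton.
Qed.

(** The relations [E n], with [W] refining [V], are a countable base of a separated uniformity
    inducing the topology of [X]. *)
Lemma embedding_metrizable (R : realType) V : accessible_space G ->
  embedding -> left_uniform_base (range j) V -> metrizable R X.
Proof.
move=> T1 [jinj jnbhs] [V1 VP].
have [W [W1 WV Ws Wdec WW]] := nbhs_sequence V1.
pose E n := [set p : X * X | W n ((j p.1)^-1 * j p.2)].
pose ent := filter_from [set: nat] E.
have entF : Filter ent.
  apply: filter_from_filter; first by exists 0.
  move=> m n _ _; exists (maxn m n) => // p Ep.
  by split; apply: (Wdec _ _ _ _ Ep); rewrite ?leq_maxl ?leq_maxr.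
have ent_diag A : ent A -> diagonal `<=` A.
  move=> [n _ EA] [x y] /diagonalP ->; apply: EA; rewrite /E /= mulVg.
  exact: nbhs_singleton.
have ent_inv A : ent A -> ent (A^-1)%relation.
  move=> [n _ EA]; exists n => // -[x y] /Ws; rewrite invgM invgK => Exy.
  exact: EA.
have ent_split A : ent A -> exists2 B, ent B & (B \; B)%relation `<=` A.
  move=> [n _ EA]; exists (E n.+1); first by exists n.+1.
  move=> [x z] [y /= xy yz]; apply: EA; rewrite /E /=.
  have -> : (j x)^-1 * j z = ((j x)^-1 * j y) * ((j y)^-1 * j z).
    by rewrite mulgA mulgK.
  exact: WW.
have ent_nbhs : nbhs = nbhs_ ent :> (X -> set_system X).
  apply/funext => x; apply/seteqP; split=> U.
    move=> /jnbhs [O Ox OU].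
    have [n nP] := VP (j x) O (ex_intro2 _ _ x I erefl) Ox.
    exists (E n); first by exists n.
    move=> y /set_mem Exy; apply: OU; apply: nP; first by exists y.
    exact: WV.
  move=> [A [n _ EA] AU]; apply/jnbhs.
  exists [set y | W n ((j x)^-1 * y)]; first exact: nbhs_lmulV.
  by move=> y Wy; apply/AU/mem_set/EA.
pose T : uniformType := HB.pack_for uniformType X
  (Nbhs_isUniform_mixin.Build X entF ent_diag ent_inv ent_split ent_nbhs).
have entE : @entourage T = ent by [].
apply: (@uniform_metrizable R T).
  apply/countable_uniformityP; exists E.
    by move=> A; rewrite entE => -[n _ EA]; exists n.
  by move=> n; rewrite entE; exists n.
move=> x y xy; apply: jinj; apply: contrapT => jxy.
have [U [/(nbhs_lmulV (j x)) Ux nU]] : exists U, nbhs 1 U /\ ~ U ((j x)^-1 * j y).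
  apply: t1_nbhs => // h; apply: jxy.
  by rewrite -[j y](mulKg (j x)^-1) h invgK mulg1.
have [n nP] := VP (j x) _ (ex_intro2 _ _ x I erefl) Ux.
apply: nU; apply: nP; first by exists y.
by apply: WV; apply: (xy (E n)); rewrite entE; exists n.
Qed.

End Embedding.

Lemma nbhs_set_type (X : topologicalType) (C : set X) (x : C) (U : set C) :
  nbhs x U <-> exists2 O, nbhs (set_val x) O & set_val @^-1` O `<=` U.
Proof.
split=> [|[O Ox OU]]; last first.
  by apply: filterS OU _; exact: (@initial_continuous C X set_val x).
rewrite nbhsE => -[B [[O oO <-] Bx] BU].
exists O; last exact: BU.
by exists O.
Qed.

Lemma embedding_set_val (G : topologicalGroupType) (X : topologicalType)
  (j : X -> G) (C : set X) : embedding j -> embedding (fun x : C => j (set_val x)).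
Proof.
move=> [jinj jnbhs]; split=> [x y /jinj /val_inj //|x U]; split.
  move=> /nbhs_set_type [O /jnbhs [P Px PO] OU]; exists P => // y Py.
  by apply: OU; exact: PO.
move=> [O Ox OU]; apply/nbhs_set_type; exists (j @^-1` O) => //.
by apply/jnbhs; exists O.
Qed.

Lemma embedding_continuous (G : topologicalGroupType) (X : topologicalType)
  (j : X -> G) : embedding j -> continuous j.
Proof. by move=> [_ jn] x U Ux; apply/jn; exists U. Qed.

(** In a sequential space closedness is tested on convergent sequences, and each has a subsequence
    lying with its limit in one [C i]. *)
Lemma inductive_topology_seq (X : topologicalType) (I : Type) (C : I -> set X) :
  sequential_space X -> (forall i, closed (C i)) ->
  (forall u x, conv u x -> exists i, io (C i \o u)) ->
  inductive_topology (range C).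
Proof.
move=> seqX cC CP; split.
  apply/seteqP; split => // x _; have [i /(_ 0) [n _ Cx]] := CP _ _ (@conv_cst X x).
  by exists (C i) => //; exists i.
move=> F; split=> [cF A _|cF].
  by apply: (closed_comp _ cF) => x _; exact: (@initial_continuous A X set_val).
apply: sequential_closed => // u x uF ux.
have [i /io1_subseq [g gi gC]] := CP u x ux.
have ugx := conv_subseq gi ux.
have Cx : C i x by apply: (conv_closed (cC i) ugx) => n; exists n => //; exact: gC.
pose v n : C i := exist _ (u (g n)) (mem_set (gC n)).
pose y : C i := exist _ x (mem_set Cx).
have vy : conv v y.
  move=> U /nbhs_set_type [O /ugx [n nP] OU]; exists n => m nm; apply: OU.
  exact: nP.
have cFC : closed ((@set_val X (C i)) @^-1` F) by apply: cF; exists i.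
by apply: (conv_closed cFC vy) => n; exists n => //; exact: uF.
Qed.

(** * The open subgroup *)

Section Words.
Variable G : topologicalGroupType.
Local Open Scope group_scope.
Hypothesis T1 : accessible_space G.
Hypothesis seqG : sequential_space G.

Lemma seq_compact_closed (C : set G) : seq_compact C -> closed C.
Proof.
move=> scC; apply: sequential_closed => // u x uC ux.
have [y [g [gi Cy ugy]]] := scC u uC.
by rewrite (conv_unique T1 (conv_subseq gi ux) ugy).
Qed.

Variable K : nat -> set G.
Hypothesis KP : compact_cs_network K.

Fixpoint words (w : seq nat) : set G :=
  if w is i :: w' then [set a * b | a in K i & b in words w'] else [set 1].

Lemma words_cat w w' a b : words w a -> words w' b -> words (w ++ w') (a * b).
Proof.
elim: w a => [|i w IH] a /=; first by move=> ->; rewrite mul1g.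
move=> [x Kx [y wy <-]] wb; exists x => //; exists (y * b); first exact: IH.
by rewrite mulgA.
Qed.

Lemma words_letter i a : K i a -> words [:: i] a.
Proof. by move=> Ka; exists a => //; exists 1 => //; rewrite mulg1. Qed.

Lemma words_inv w a : words w a -> words (rev w) a^-1.
Proof.
elim: w a => [|i w IH] a /=; first by move=> ->; rewrite invg1.
move=> [x Kx [y wy <-]]; rewrite rev_cons -cats1 invgM.
by apply: words_cat; [exact: IH|apply: words_letter; have [_ KV _] := KP; exact: KV].
Qed.

Lemma words_seq_compact w : seq_compact (words w).
Proof.
elim: w => [|i w IH] u uw.
  exists 1, id; split => //; have -> : u \o id = fun=> 1 by apply/funext => n; exact: uw.
  exact: conv_cst.
have /choice [a aP] : forall n, exists a, K i a /\ exists b, words w b /\ u n = a * b.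
  by move=> n; have [a Ka [b wb <-]] := uw n; exists a; split=> //; exists b.
have /choice [b bP] : forall n, exists b, words w b /\ u n = a n * b.
  by move=> n; have [_] := aP n.
have [scK _ _] := KP.
have [x [g [gi Kx ax]]] := scK i a (fun n => (aP n).1).
have [y [h [hi wy bx]]] := IH (b \o g) (fun n => (bP (g n)).1).
exists (x * y), (g \o h); split; first exact: incr_comp.
  by exists x => //; exists y.
have := convM (conv_subseq hi ax) bx; apply: conv_near; exists 0 => n _ /=.
by have [_ ->] := bP (g (h n)).
Qed.

Lemma words_closed w : closed (words w).
Proof. by apply: seq_compact_closed; exact: words_seq_compact. Qed.

Definition hull : set G := [set x | exists w, words w x].

Lemma hull1 : hull 1. Proof. by exists [::]. Qed.

Lemma hullM a b : hull a -> hull b -> hull (a * b).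
Proof. by move=> [w wa] [w' wb]; exists (w ++ w'); exact: words_cat. Qed.

Lemma hullV a : hull a -> hull a^-1.
Proof. by move=> [w wa]; exists (rev w); exact: words_inv. Qed.

(** The sequence x^-1 u_n tends to 1 and so meets some [K i] infinitely often; this letter is
    appended to a word for [x]. *)
Lemma hull_catch u x : conv u x -> hull x -> exists w, io (words w \o u).
Proof.
move=> ux [w wx]; have [_ _ /(_ _ (conv_lmulV ux)) [i iK]] := KP.
exists (w ++ [:: i]) => n; have [m nm Km] := iK n; exists m => //.
rewrite /= -[u m](mulVKg x); apply: words_cat => //; exact: words_letter.
Qed.

Lemma hull_open : open hull.
Proof.
rewrite -closedC; apply: sequential_closed => // u x uH ux Hx.
have [w /(_ 0) [n _ /= wu]] := hull_catch ux Hx.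
by apply: (uH n); exists w.
Qed.

Lemma hull_nbhs : nbhs 1 hull.
Proof. by apply: open_nbhs_nbhs; split; [exact: hull_open|exact: hull1]. Qed.

Lemma hull_closed : closed hull.
Proof.
move=> x /(_ _ (nbhs_lmulV x hull_nbhs)) [y [Hy /= /hullV Hxy]].
by rewrite -[x](mulVKg y) -(invgK (y^-1 * x)) invgM invgK; apply: hullM.
Qed.

(* For a choice [r] of coset representatives of [hull], [tube r w] consists of the
   translates of [words w] to all cosets; for [r] constantly 1 it is [words w]. *)
Definition tube (r : G -> G) w : set G := [set g | words w ((r g)^-1 * g)].

Variable r : G -> G.
Hypothesis rH : forall x y, hull (x^-1 * y) -> r x = r y.

(** Since [hull] is open, points near [x] lie in its coset, where [r] is constant; this reduces the
    claim to [words w]. *)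
Lemma tube_closed w : closed (tube r w).
Proof.
apply: sequential_closed => // u x uT ux.
have [n nP] := ux _ (nbhs_lmulV x hull_nbhs).
rewrite /tube /=; apply: (conv_closed (@words_closed w) (@conv_lmul _ (r x)^-1 _ _ ux)) => m.
exists (maxn m n); first exact: leq_maxl.
have := uT (maxn m n); rewrite /tube /= -(rH (nP _ _)) //; exact: leq_maxr.
Qed.

Lemma tube_catch u x : conv u x -> hull ((r x)^-1 * x) ->
  exists w, io (tube r w \o u).
Proof.
move=> ux /(hull_catch (@conv_lmul _ (r x)^-1 _ _ ux)) [w wP]; exists w => k.
have [n nP] := ux _ (nbhs_lmulV x hull_nbhs).
have [m] := wP (maxn k n); rewrite geq_max => /andP [km /nP/rH rE] wm.
by exists m => //; rewrite /tube /= -rE.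
Qed.

Variable N : nat -> set G.
Hypothesis csN : closed_cs_network N.

(** Within a coset, quotients x^-1 y of points of the tube lie in the sequentially compact set
    [words (rev w ++ w)], of which 1 is a G_delta point. If y_n is in the tube and x^-1 y_n in
    [W n], a subsequence converges and the quotient of its limit by x is in every [S n], so it is
    1. *)
Lemma tube_left_uniform w : exists V, left_uniform_base (tube r w) V.
Proof.
have [S [S1 cS SP]] := point_sequence_seq_compact T1 seqG csN
  (@words_seq_compact (rev w ++ w)).
(* Intersecting with [hull] keeps the points y_n in the coset of x. *)
have [W [W1 WS _ Wdec _]] := nbhs_sequence (fun n => filterI (S1 n) hull_nbhs).
exists W; split => // x O wx Ox; apply: contrapT => /forallNP nW.
have /choice [y yP] : forall n, exists y,
    [/\ tube r w y, W n (x^-1 * y) & ~ O y].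
  by move=> n; have /existsNP [y /not_implyP [? /not_implyP [? ?]]] := nW n; exists y.
have ry n : r (y n) = r x.
  by apply/esym/rH; have [_ /WS [_]] := yP n.
have yw n : words w ((r x)^-1 * y n) by have [] := yP n; rewrite /tube /= ry.
have [l [g [gi wl yl]]] := words_seq_compact yw.
have xl : ((r x)^-1 * x)^-1 * l = 1.
  apply: SP; first by apply: words_cat => //; exact: words_inv.
  move=> n; apply: (conv_closed (cS n) (@conv_lmul _ ((r x)^-1 * x)^-1 _ _ yl)) => m.
  exists (maxn m n); first exact: leq_maxl.
  rewrite /= invgM mulgA mulgVK.
  have [_ Wy _] := yP (g (maxn m n)); apply: (proj1 (WS n _ _)).
  by apply: Wdec Wy; apply: leq_trans (incr_ge gi _); exact: leq_maxr.
have yx : conv (y \o g) x.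
  have := @conv_lmul _ (r x) _ _ yl.
  have -> : r x * l = x by rewrite -(mulVKg ((r x)^-1 * x) l) xl mulg1 mulVKg.
  by apply: conv_near; exists 0 => n _ /=; rewrite mulVKg.
have [n /(_ n (leqnn _)) /=] := yx _ Ox.
by have [_ _] := yP (g n).
Qed.

End Words.

(** * From sequential compactness to compactness *)

Section Compactness.
Variable G : topologicalGroupType.
Local Open Scope group_scope.
Implicit Types (L W : set G).

(** Otherwise a greedy choice gives a sequence in [L] no term of which is [W]-close to an earlier
    one, so no subsequence converges. *)
Lemma seq_compact_totally_bounded L W : seq_compact L -> nbhs 1 W ->
  exists s : seq G, forall y, L y -> exists2 x, x \in s & W (x^-1 * y).
Proof.
move=> scL /nbhs_sym [V [V1 Vs VW]]; apply: contrapT => /forallNP ns.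
have /choice [f fP] : forall s : seq G, exists y,
    L y /\ forall x, x \in s -> ~ W (x^-1 * y).
  move=> s; have /existsNP [y /not_implyP [Ly ny]] := ns s.
  by exists y; split=> // x xs Wxy; apply: ny; exists x.
pose l := fix l n : seq G := if n is m.+1 then f (l m) :: l m else [::].
have [x [g [gi _ fx]]] := scL (fun n => f (l n)) (fun n => (fP (l n)).1).
have lin m n : m < n -> f (l m) \in l n.
  elim: n => // n IH; rewrite ltnS leq_eqVlt => /orP [/eqP ->|/IH mn] /=.
    by rewrite mem_head.
  by rewrite in_cons mn orbT.
have [n nP] := conv_lmulV fx V1.
apply: ((fP (l (g n.+1))).2 (f (l (g n)))); first exact/lin/gi.
have -> : (f (l (g n)))^-1 * f (l (g n.+1)) =
    (x^-1 * f (l (g n)))^-1 * (x^-1 * f (l (g n.+1))).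
  by rewrite invgM invgK mulgA mulgK.
by apply: VW; [apply/Vs/nP|apply: nP].
Qed.

(** By total boundedness an ultrafilter on [L] contains, for each n, a left [W n]-ball around some
    x_n. Points y_n taken in the first balls subconverge to a point, to which the ultrafilter
    converges. *)
Lemma seq_compact_compact L V : seq_compact L -> left_uniform_base L V ->
  compact L.
Proof.
move=> scL [V1 VP].
have [W [W1 WV Ws Wdec WW]] := nbhs_sequence V1.
rewrite compact_ultra => F FU FL.
have /choice [x xP] : forall n, exists x, F [set y | W n (x^-1 * y)].
  move=> n; have [s sP] := seq_compact_totally_bounded scL (W1 n).
  apply: contrapT => /forallNP nx.
  have : F (L `&` [set y | forall x, x \in s -> ~ W n (x^-1 * y)]).
    apply: filterI => //; elim: s {sP} => [|x s IH].
      by apply: filterS filterT => y.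
    have [//|Fx] := in_ultra_setVsetC [set y | W n (x^-1 * y)] FU.
      by move=> /nx.
    apply: filterS (filterI Fx IH) => y [nW ys] z; rewrite in_cons.
    by move=> /orP [/eqP -> //|/ys].
  move=> /filter_ex [y [/sP [z zs Wzy]] /(_ z zs)]; exact.
have /choice [y yP] : forall n, exists y, L y /\
    forall m, m <= n -> W m ((x m)^-1 * y).
  move=> n; suff : F (L `&` [set y | forall m, m <= n -> W m ((x m)^-1 * y)]).
    by move=> /filter_ex [y [Ly yW]]; exists y.
  apply: filterI => //; elim: n => [|n IH].
    by apply: filterS (xP 0) => y Wy m; rewrite leqn0 => /eqP ->.
  apply: filterS (filterI (xP n.+1) IH) => y [Wy IHy] m.
  by rewrite leq_eqVlt => /orP [/eqP -> //|]; rewrite ltnS => /IHy.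
have [p [g [gi Lp yp]]] := scL y (fun n => (yP n).1).
exists p; split=> // O Op; have [n nP] := VP p O Lp Op.
(* The two spare indices pay for two products: x_{n+2} to p through a late y, then p to z through
   x_{n+2}. *)
have xp : W n.+1 ((x n.+2)^-1 * p).
  have [m mP] := conv_lmulV yp (W1 n.+2).
  set k := maxn m n.+2.
  have := Ws _ _ (mP k (leq_maxl _ _)); rewrite invgM invgK => Wyp.
  rewrite -(mulVKg (y (g k)) p) mulgA; apply: WW => //.
  by apply: (yP (g k)).2; apply: leq_trans (incr_ge gi k); exact: leq_maxr.
have : F (L `&` [set z | W n.+2 ((x n.+2)^-1 * z)]) by exact: filterI.
apply: filterS => z [Lz Wz]; apply: nP => //; apply: WV.
have -> : p^-1 * z = ((x n.+2)^-1 * p)^-1 * ((x n.+2)^-1 * z).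
  by rewrite invgM invgK mulgA mulgK.
by apply: WW; [exact: Ws|exact: (Wdec n.+1 n.+2)].
Qed.

Lemma embedding_compact (X : topologicalType) (j : X -> G) L :
  embedding j -> L `<=` range j -> compact L -> compact (j @^-1` L).
Proof.
move=> [jinj jnbhs] Lj cL F FF FL.
have [p [Lp Fp]] := cL (j @ F) _ FL.
have [x _ jx] := Lj p Lp; exists x; split; first by rewrite /= jx.
move=> A B FA /jnbhs [O Ox OB].
have FjA : F (j @^-1` (j @` A)) by apply: filterS FA => a Aa; exists a.
rewrite jx in Ox.
have [_ [[a Aa <-] Oa]] := Fp _ _ FjA Ox.
by exists a; split=> //; exact: OB.
Qed.

End Compactness.

(** * Coset decomposition over the open subgroup *)

Section Structure.
Variables (R : realType) (G : topologicalGroupType).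
Local Open Scope group_scope.
Hypothesis T1 : accessible_space G.
Hypothesis seqG : sequential_space G.
Variables (N K : nat -> set G).
Hypothesis csN : closed_cs_network N.
Hypothesis KP : compact_cs_network K.

(** A coset representative: the set given to [xget] depends only on the coset of [x]. *)
Let rep (x : G) : G := xget 1 [set y | hull K (x^-1 * y)].

Let rep_hull x : hull K (x^-1 * rep x).
Proof.
suff : [set y | hull K (x^-1 * y)] (rep x) by [].
by apply: xgetPex; exists x; rewrite /= mulVg; exact: hull1.
Qed.

Let repV_hull x : hull K ((rep x)^-1 * x).
Proof. by have := hullV KP (rep_hull x); rewrite invgM invgK. Qed.

Let rep_eq x y : hull K (x^-1 * y) -> rep x = rep y.
Proof.
move=> xy; congr xget; apply/seteqP; split=> z /= h.
  have -> : y^-1 * z = (x^-1 * y)^-1 * (x^-1 * z) by rewrite invgM invgK mulgA mulgK.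
  by apply: hullM => //; exact: (hullV KP).
have -> : x^-1 * z = (x^-1 * y) * (y^-1 * z) by rewrite mulgA mulgK.
exact: hullM.
Qed.

(** General [r] and [j] serve two cases: [G] itself with coset representatives, and the subgroup
    with [r] constantly 1. *)
Lemma tube_inductive (r : G -> G) (X : topologicalType) (j : X -> G) :
  (forall x y, hull K (x^-1 * y) -> r x = r y) ->
  embedding j -> sequential_space X ->
  (forall x, hull K ((r (j x))^-1 * j x)) ->
  let CC := range (fun w => j @^-1` tube K r w) in
  [/\ countable CC, forall C, CC C -> closed C /\ metrizable R (set_type C) &
      inductive_topology CC].
Proof.
move=> rH ej seqX jH CC.
have jc := embedding_continuous ej.
have cC w : closed (j @^-1` tube K r w).
  by apply: (closed_comp _ (tube_closed T1 seqG KP rH (w := w))) => x _; exact: jc.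
split.
- exact: (card_le_trans (card_image_le _ _) (countableP _)).
- move=> _ [w _ <-]; split => //.
  have [V [V1 VP]] := tube_left_uniform T1 seqG KP rH csN w.
  apply: (@embedding_metrizable _ _ _ R V T1
    (@embedding_set_val G X j (j @^-1` tube K r w) ej)).
  split=> // _ O [x _ <-] xO; have [n nP] := VP _ _ (set_mem (valP x)) xO.
  by exists n => _ [y _ <-]; apply: nP; exact: (set_mem (valP y)).
- apply: inductive_topology_seq => // u x ux.
  exact: (tube_catch seqG KP rH (conv_continuous jc ux) (jH x)).
Qed.

Lemma hull_group_closed : group_closed (mem (hull K)).
Proof.
split=> [|x y /set_mem Hx /set_mem Hy]; first exact/mem_set/hull1.
by apply/mem_set/hullM => //; exact: (hullV KP).
Qed.

Let H : subgroup G := Subgroup hull_group_closed.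

Let valH : subgroup_type H -> G := \val.

Let embedding_valH : embedding valH.
Proof. by split=> [x y /val_inj //|x U]; exact: nbhs_set_type. Qed.

Let sequential_H : sequential_space (subgroup_type H).
Proof.
move=> A AP.
suff cA : closed (valH @` A).
  have -> : A = valH @^-1` (valH @` A).
    by apply/seteqP; split=> [x Ax|x [y Ay /val_inj <-]] //; exists x.
  by apply: (closed_comp _ cA) => x _; exact: embedding_continuous.
apply: sequential_closed => // u x uA ux.
have Hx : hull K x.
  apply: (conv_closed (hull_closed seqG KP) ux) => n; exists n => //=.
  by have [y _ <-] := uA n; exact: (set_mem (valP y)).
pose x' : subgroup_type H := exist _ x (mem_set Hx).
have /choice [v vP] : forall n, exists y, A y /\ valH y = u n.
  by move=> n; have [y Ay yu] := uA n; exists y.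
exists x' => //; apply: (AP v); first by move=> n; have [] := vP n.
apply/convP => U /nbhs_set_type [O /ux [n nP] OU]; exists n => m nm; apply: OU.
by have [_ vE] := vP m; have := nP m nm; rewrite -vE.
Qed.

Lemma hull_MK_omega : MK_omega_space R (subgroup_type H).
Proof.
have [cCC CCP CCind] := @tube_inductive (fun=> 1) _ valH (fun _ _ _ => erefl)
  embedding_valH sequential_H (fun x => let: h := set_mem (valP x) in
    eq_ind_r (hull K) h (etrans (congr1 (fun y => y * _) (invg1 _)) (mul1g _))).
exists (range (fun w => valH @^-1` tube K (fun=> 1) w)); split=> // C CC.
have [cC mC] := CCP C CC; split=> //; case: CC => w _ <-.
have [V VP] := tube_left_uniform T1 seqG KP (r := fun=> 1) (fun _ _ _ => erefl) csN w.
have tubeE : tube K (fun=> 1) w = words K w.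
  by apply/seteqP; split=> x; rewrite /tube /= invg1 mul1g.
rewrite tubeE in VP *; apply: embedding_compact embedding_valH _ _.
  move=> x wx; have Hx : hull K x by exists w.
  by exists (exist _ x (mem_set Hx)).
exact: seq_compact_compact (words_seq_compact KP (w := w)) VP.
Qed.

Lemma hull_M_omega : M_omega_space R G.
Proof.
have eid : embedding (@id G).
  by split=> // x U; split=> [Ux|[O Ox OU]]; [exists U|exact: filterS OU Ox].
have := tube_inductive rep_eq eid seqG repV_hull.
by exists (range (fun w => id @^-1` tube K rep w)).
Qed.

Let D := discrete_topology (set_type [set d | rep d = d]).

Let rep_rep x : rep (rep x) = rep x.
Proof. by apply/esym/rep_eq; exact: rep_hull. Qed.

(** The map x |-> (rep(x)^-1 x, rep(x)) has inverse (a, d) |-> d a, and it is continuous since [rep]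
    is locally constant. *)
Lemma hull_product : exists D : discreteTopologicalType,
  homeomorphic G (subgroup_type H * D)%type.
Proof.
exists D.
have subP x : (rep x)^-1 * x \in (H : set G) by apply/mem_set; exact: repV_hull.
have repP x : rep x \in [set d | rep d = d] by apply/mem_set; exact: rep_rep.
pose h x : subgroup_type H := exist (fun z => z \in (H : set G)) _ (subP x).
pose e x : D := exist (fun z => z \in [set d | rep d = d]) _ (repP x).
pose f (x : G) : subgroup_type H * D := (h x, e x).
pose valD (d : D) : G := sval d.
pose g (z : subgroup_type H * D) : G := valD z.2 * valH z.1.
have near_rep x : nbhs x [set y | rep y = rep x].
  by apply: filterS (nbhs_lmulV x (hull_nbhs seqG KP)) => y /= /rep_eq.
exists f, g; split.
- by move=> x; rewrite /f /g /valH /= mulVKg.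
- move=> [a d]; have aH : hull K (valH a) by exact: (set_mem (valP a)).
  have dE : rep (valD d) = valD d by exact: (set_mem (svalP d)).
  have gE : rep (g (a, d)) = valD d.
    by rewrite -[RHS]dE; apply/esym/rep_eq; rewrite /g /= mulKg.
  by congr pair; apply: val_inj => //=; rewrite gE // /g /= mulKg.
- move=> x.
  have hx : h @ x --> h x.
    move=> U /nbhs_set_type [O Ox OU].
    apply: filterS (filterI (near_rep x) (@lmulg_continuous G (rep x)^-1 x _ Ox)).
    by move=> y [/= rE]; rewrite -rE => Oy; exact: OU.
  have ex : e @ x --> e x.
    move=> U Ux; apply: filterS (near_rep x) => y /= rE.
    have -> : e y = e x by exact: val_inj.
    exact: nbhs_singleton Ux.
  exact: (cvg_pair hx ex).
- move=> z; apply: (@continuous_comp _ _ _ (fun z : subgroup_type H * D =>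
    (valD z.2, valH z.1)) (fun p : G * G => p.1 * p.2)); last exact: mulg_continuous.
  apply: cvg_pair.
    apply: (@continuous_comp _ _ _ snd valD); first exact: cvg_snd.
    move=> U Ux; apply: filterS (discrete_set1 _) => d ->; exact: nbhs_singleton Ux.
  apply: continuous_comp; first exact: cvg_fst.
  exact: embedding_continuous.
Qed.

End Structure.

Theorem theorem1 (R : realType) (G : topologicalGroupType)
  (T1_G : accessible_space G)
  (sequential_G : sequential_space G)
  (cs_G : countable_cs_star_character G) :
  M_omega_group R G /\
  (metrizable R G \/
   exists H : subgroup G,
     [/\ open (subgroup_set H),
         MK_omega_group R (subgroup_type H) &
         exists D : discreteTopologicalType,
           homeomorphic G (subgroup_type H * D)%type]).
Proof.
have [N csN] := closed_cs_network_ex cs_G.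
have [[t tfan]|[B [B1 BP]]] := fan_or_base sequential_G csN.
  have [K KP] := fan_compact_network T1_G sequential_G csN tfan.
  split; first exact: (hull_M_omega R T1_G sequential_G csN KP).
  right; exists (Subgroup (hull_group_closed KP)); split.
  - exact: (hull_open sequential_G KP).
  - exact: (hull_MK_omega R T1_G sequential_G csN KP).
  - exact: (hull_product sequential_G KP).
have metG Z : left_uniform_base Z B.
  split=> // x O _ /nbhs_lmul /BP [n nP]; exists n => y _ /nP /=.
  by rewrite mulVKg.
have eid : embedding (@id G).
  by split=> // x U; split=> [Ux|[O Ox OU]]; [exists U|exact: filterS OU Ox].
split; last by left; exact: (embedding_metrizable R T1_G eid (metG _)).
exists [set setT]; split.
- exact: countable1.
- move=> _ ->; split; first exact: closedT.
  exact: (@embedding_metrizable _ _ _ R B T1_G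
    (@embedding_set_val G G id setT eid) (metG _)).
have -> : [set setT] = range (fun _ : unit => [set: G]).
  by apply/seteqP; split=> [_ ->|_ [_ _ <-]] //; exists tt.
apply: inductive_topology_seq => // u x _.
by exists tt => n; exists n.
Qed.
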